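(* Suppose $C$ and $\Phi$ satisfy the standing assumptions (S1)–(S3) and the assumptions (A1), (A2), (A3) listed in the context, with constants $L$ and $\zeta$. Let $T>0$ be such that $T^2(L+1)\le \frac{\zeta}{L+1}$. Let $v\sim\mathcal{N}(0,C)$, and for $q\in\mathcal{H}^l$ let $q'(q,v)$ denote the position component of $\varphi_T(q,v)$, where $\varphi_T$ is the exact time-$T$ flow defined in the context. Write $x'(x,v)=q'(x,v)$ and $y'(y,v)=q'(y,v)$ (the same random $v$ is used for both). Then for all $x,y\in\mathcal{H}^l$, $$\mathbb{E}\left[\|x'(x,v)-y'(y,v)\|_l\right]\le\left(1-\tfrac{1}{27}\zeta T^2\right)\|x-y\|_l ,$$ where the expectation is over $v$.
   Context: Spaces. $(\mathcal{H},\langle\cdot,\cdot\rangle)$ is a real separable infinite-dimensional Hilbert space, $\pi_0=\mathcal{N}(0,C)$ a centred Gaussian measure on it with injective covariance operator $C$; $\{\phi_j\}_{j\ge1}$ is an orthonormal eigenbasis, $C\phi_j=\lambda_j^2\phi_j$, $\lambda_j>0$. For $s\in\mathbb{R}$, $\mathcal{H}^s$ is the Hilbert space obtained by completing the span of the $\phi_j$ with respect to $\langle f,g\rangle_s=\sum_{j\ge1} j^{2s}\langle f,\phi_j\rangle\langle g,\phi_j\rangle$, with norm $\|\cdot\|_s$; $\mathcal{H}^{-s}$ is identified with the dual of $\mathcal{H}^s$ via the extension of $\langle\cdot,\cdot\rangle$. $C$ acts diagonally on all these spaces. Standing assumptions. (S1) There is $\kappa>\frac12$ with $0<\liminf_j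 j^\kappa\lambda_j\le\limsup_j j^\kappa\lambda_j<\infty$. (S2) There is a fixed $l\in[0,\kappa-\frac12)$ such that $\Phi:\mathcal{H}^l\to\mathbb{R}$ is continuous and its Fréchet derivative $D\Phi:\mathcal{H}^l\to\mathcal{H}^{-l}$ is globally Lipschitz. (S3) For every $\epsilon>0$ there is $K(\epsilon)\in\mathbb{R}$ with $\Phi(q)\ge K(\epsilon)-\epsilon\|q\|_l^2$ for all $q\in\mathcal{H}^l$. Under (S1), $\pi_0(\mathcal{H}^l)=1$, and under (S1)–(S2), $C\,D\Phi$ maps $\mathcal{H}^l$ to $\mathcal{H}^l$ and is Lipschitz. Further assumptions. (A1) $L>0$ and $L'\ge 0$ are constants such that for all $q,q'\in\mathcal{H}^l$: $\|D\Phi(q)-D\Phi(q')\|_{-l}\le L\|q-q'\|_l$, $\|C D\Phi(q)-C D\Phi(q')\|_l\le L\|q-q'\|_l$, $\|D\Phi(q)\|_{-l}\le L\|q\|_l+L'$, and $\|C D\Phi(q)\|_l\le L\|q\|_l+L'$. (A2) $\zeta>0$ is a constant with $\zeta\le L+1$ such that for all $x,y\in\mathcal{H}^l$: $\langle x-y,x-y\rangle_l+\langle C D\Phi(x)-C D\Phi(y),x-y\rangle_l\ge\zeta\|x-y\|_l^2$. (A3) $\Phi:\mathcal{H}^l\to\mathbb{R}$ is $C^4$, and there are constants $M,N_\Phi$ such that for all $x,y\in\mathcal{H}^l$: $\|D^2\Phi(x)-D^2\Phi(y)\|_{\mathcal{H}^l\to\mathcal{H}^{-l}}\le M\|x-y\|_l$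 (i.e. $\|D^3\Phi\|\le M$), $\|C D^2\Phi(x)-C D^2\Phi(y)\|_{\mathcal{H}^l\to\mathcal{H}^{l}}\le M\|x-y\|_l$, and $\|D^4\Phi(x)\|\le N_\Phi$ (norm as a multilinear form on $\mathcal{H}^l$). Exact flow. $\varphi_t:\mathcal{H}^l\times\mathcal{H}^l\to\mathcal{H}^l\times\mathcal{H}^l$ is the flow of $\frac{dq}{dt}=v,\ \frac{dv}{dt}=-q-C D\Phi(q)$. *)

(* Defs.v *)
From HB Require Import structures.
From mathcomp Require Import all_boot all_order all_algebra.
From mathcomp Require Import all_classical all_reals all_analysis.
From mathcomp Require Import ring lra.

Set Implicit Arguments.
Unset Strict Implicit.
Unset Printing Implicit Defensive.

Import Order.TTheory GRing.Theory Num.Theory.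
Import numFieldNormedType.Exports.

Local Open Scope classical_set_scope.
Local Open Scope ring_scope.

HB.mixin Record NormedModule_hasInner (R : realType) V & NormedModule R V := {
  inner : V -> V -> R ;
  innerC : forall x y, inner x y = inner y x ;
  innerDl : forall x y z, inner (x + y) z = inner x z + inner y z ;
  innerZl : forall a x y, inner (a *: x) y = a * inner x y ;
  innerxx : forall x, inner x x = `|x| ^+ 2 }.

#[short(type="hilbertType")]
HB.structure Definition Hilbert (R : realType) :=
  {V of CompleteNormedModule R V & NormedModule_hasInner R V}.

(* The space H^s is realized as the weighted l^2 space of the coefficients of
   its elements on the basis; index j : nat stands for the (j+1)-st basis
   vector. That this is the completion of the span of the basis for <.,.>_s is
   the content of the hilbertType instance below together with [Hs_basis_inner]
   and [Hs_basis_cvg]. *)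
Section sobolev_scale.
Context {R : realType}.
Implicit Types (s : R) (a b : nat -> R).

Definition weight s (j : nat) : R := j.+1%:R `^ (2 * s).

Lemma weight_gt0 s j : 0 < weight s j.
Proof. by rewrite /weight powR_gt0. Qed.

Definition sobolev s a : Prop :=
  cvgn (series (fun j => weight s j * a j ^+ 2)).

Definition sobolev_pred s : pred (nat -> R) := fun a => `[< sobolev s a >].

Record Hs s := MkHs { coef :> nat -> R ; _ : coef \in sobolev_pred s }.

Lemma cvg_series_le s a (u : nat -> R) :
  (forall j, `|u j| <= weight s j * a j ^+ 2) -> sobolev s a ->
  cvgn (series u).
Proof.
move=> ua sa; apply: normed_cvg.
apply: (series_le_cvg _ _ _ sa) => n; [exact: normr_ge0| |exact: ua].
by rewrite mulr_ge0 ?sqr_ge0// ltW// weight_gt0.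
Qed.

Lemma sobolev_bound s a M :
  (forall n, \sum_(0 <= j < n) weight s j * a j ^+ 2 <= M) -> sobolev s a.
Proof.
move=> aM; apply: nondecreasing_is_cvgn.
  apply: nondecreasing_series => j _ _.
  by rewrite mulr_ge0 ?sqr_ge0// ltW// weight_gt0.
by exists M => _ [n _ <-]; exact: aM.
Qed.

Lemma sobolev_cross s a b : sobolev s a -> sobolev s b ->
  cvgn (series (fun j => weight s j * (a j * b j))).
Proof.
move=> sa sb; apply: normed_cvg.
apply: (series_le_cvg _ _ _ (is_cvg_seriesD sa sb)) => n /=;
  rewrite ?normr_ge0// ?fctE.
  by rewrite addr_ge0// mulr_ge0 ?sqr_ge0// ltW// weight_gt0.
rewrite -mulrDr normrM gtr0_norm ?weight_gt0// ler_pM2l ?weight_gt0//.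
rewrite ler_norml; nra.
Qed.

Lemma sobolev_submod s : submod_closed (sobolev_pred s).
Proof.
split.
  apply/asboolP; apply: (@sobolev_bound _ _ 0) => n.
  by rewrite big1// => j _ /=; rewrite expr0n mulr0.
move=> c a b /asboolP sa /asboolP sb; apply/asboolP.
have scr := sobolev_cross sa sb.
have := is_cvg_seriesD (is_cvg_seriesZ (k := c ^+ 2) sa)
  (is_cvg_seriesD (is_cvg_seriesZ (k := 2 * c) scr) sb).
rewrite /sobolev; congr (cvgn (series _)); apply/funext => j /=;
  rewrite !fctE /GRing.scale/=; ring.
Qed.

End sobolev_scale.

Section sobolev_module.
Context {R : realType} (s : R).

HB.instance Definition _ := [isSub for (@coef R s)].
HB.instance Definition _ := gen_eqMixin (Hs s).
HB.instance Definition _ := gen_choiceMixin (Hs s).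
HB.instance Definition _ := GRing.isSubmodClosed.Build R (nat -> R)
  (sobolev_pred s) (sobolev_submod s).
HB.instance Definition _ := [SubChoice_isSubLmodule of (Hs s) by <:].

Implicit Types f g h : Hs s.

Local Notation inn f g := (limn (series (fun j => weight s j * (f j * g j)))).

Lemma HsD (f g : Hs s) j : (f + g) j = f j + g j.
Proof. by []. Qed.

Lemma HsZ a (f : Hs s) j : (a *: f) j = a * f j.
Proof. by []. Qed.

Lemma HsN (f : Hs s) j : (- f) j = - f j.
Proof. by []. Qed.

Lemma Hs0 j : (0 : Hs s) j = 0.
Proof. by []. Qed.

Lemma HsP (f : Hs s) : sobolev s f.
Proof. by case: f => f /= /asboolP. Qed.
Arguments HsP : clear implicits.

Lemma Hs_ext (f g : Hs s) : (forall j, f j = g j) -> f = g.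
Proof. by move=> fg; apply/val_inj/funext. Qed.

Definition Hs_inner (f g : Hs s) : R := inn f g.

Lemma Hs_innerC f g : Hs_inner f g = Hs_inner g f.
Proof.
congr (limn (series _)); apply/funext => j; by rewrite (mulrC (f j)).
Qed.

Lemma Hs_innerDl f g h : Hs_inner (f + g) h = Hs_inner f h + Hs_inner g h.
Proof.
have := lim_seriesD (sobolev_cross (HsP f) (HsP h))
  (sobolev_cross (HsP g) (HsP h)).
rewrite /Hs_inner => <-.
congr (limn (series _)); apply/funext => j; rewrite HsD fctE; ring.
Qed.

Lemma Hs_innerZl a f g : Hs_inner (a *: f) g = a * Hs_inner f g.
Proof.
apply: etrans (lim_seriesZ a (sobolev_cross (HsP f) (HsP g))).
by congr (limn (series _)); apply/funext => j; rewrite HsZ -mulrA mulrCA.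
Qed.

Lemma Hs_inner_ge f n :
  \sum_(0 <= j < n) weight s j * f j ^+ 2 <= Hs_inner f f.
Proof.
rewrite /Hs_inner.
under [X in series X]eq_fun do rewrite -expr2.
apply: (nondecreasing_cvgn_le _ (HsP f)).
apply: nondecreasing_series => j _ _.
by rewrite mulr_ge0 ?sqr_ge0// ltW// weight_gt0.
Qed.

Lemma Hs_inner_le f M :
  (forall n, \sum_(0 <= j < n) weight s j * f j ^+ 2 <= M) ->
  Hs_inner f f <= M.
Proof.
move=> fM; rewrite /Hs_inner.
under [X in series X]eq_fun do rewrite -expr2.
by apply: limr_le; [exact: HsP|exact: nearW].
Qed.

Lemma Hs_inner_ge0 f : 0 <= Hs_inner f f.
Proof. by have := Hs_inner_ge f 0; rewrite big_geq. Qed.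

Lemma Hs_coef_le f j : weight s j * f j ^+ 2 <= Hs_inner f f.
Proof.
apply: le_trans (Hs_inner_ge f j.+1); rewrite big_nat_recr//= lerDr.
by apply: sumr_ge0 => i _; rewrite mulr_ge0 ?sqr_ge0// ltW// weight_gt0.
Qed.

Lemma Hs_inner_eq0 f : Hs_inner f f = 0 -> f = 0.
Proof.
move=> f0; apply: Hs_ext => j; rewrite Hs0.
have := Hs_coef_le f j; rewrite f0 pmulr_rle0 ?weight_gt0// => fj.
by apply/eqP; rewrite -sqrf_eq0 eq_le fj sqr_ge0.
Qed.

Lemma Hs_innerDr f g h : Hs_inner h (f + g) = Hs_inner h f + Hs_inner h g.
Proof. by rewrite Hs_innerC Hs_innerDl !(Hs_innerC h). Qed.

Lemma Hs_innerZr a f g : Hs_inner g (a *: f) = a * Hs_inner g f.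
Proof. by rewrite Hs_innerC Hs_innerZl (Hs_innerC g). Qed.

Lemma Hs_cauchy_schwarz f g :
  Hs_inner f g ^+ 2 <= Hs_inner f f * Hs_inner g g.
Proof.
have [f0|fn0] := eqVneq (Hs_inner f f) 0.
  have -> : f = 0 by exact: Hs_inner_eq0.
  by rewrite -(scale0r f) !Hs_innerZl !mul0r expr0n.
have fgt0 : 0 < Hs_inner f f by rewrite lt_def fn0 Hs_inner_ge0.
have := Hs_inner_ge0 (Hs_inner f f *: g + - Hs_inner f g *: f).
rewrite !(Hs_innerDl, Hs_innerDr, Hs_innerZl, Hs_innerZr) (Hs_innerC g f).
move: fgt0; set a := Hs_inner f f; set b := Hs_inner f g.
set c := Hs_inner g g => a0 H; rewrite -subr_ge0 -(pmulr_rge0 _ a0).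
by apply: le_trans H _; rewrite le_eqVlt; apply/orP; left; apply/eqP; ring.
Qed.

Definition Hs_norm (f : Hs s) : R := Num.sqrt (Hs_inner f f).

Lemma Hs_normD f g : Hs_norm (f + g) <= Hs_norm f + Hs_norm g.
Proof.
rewrite -ler_sqr ?nnegrE ?addr_ge0 ?sqrtr_ge0// sqrrD !sqr_sqrtr ?Hs_inner_ge0//.
rewrite Hs_innerDl !Hs_innerDr (Hs_innerC g f).
have : Hs_inner f g <= Hs_norm f * Hs_norm g.
  rewrite (le_trans (ler_norm _))//.
  rewrite -ler_sqr ?nnegrE ?mulr_ge0 ?sqrtr_ge0// exprMn.
  rewrite !sqr_sqrtr ?Hs_inner_ge0// real_normK ?num_real//.
  exact: Hs_cauchy_schwarz.
by rewrite mulr2n; lra.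
Qed.

Lemma Hs_normZ a f : Hs_norm (a *: f) = `|a| * Hs_norm f.
Proof.
by rewrite /Hs_norm Hs_innerZl Hs_innerZr mulrA -expr2 sqrtrM ?sqr_ge0// sqrtr_sqr.
Qed.

Lemma Hs_norm_eq0 f : Hs_norm f = 0 -> f = 0.
Proof.
move/eqP; rewrite sqrtr_eq0 => f0; apply: Hs_inner_eq0.
by apply/eqP; rewrite eq_le f0 Hs_inner_ge0.
Qed.

HB.instance Definition _ :=
  Lmodule_isNormed.Build R (Hs s) Hs_normD Hs_normZ Hs_norm_eq0.

Lemma Hs_normE (f : Hs s) : `|f| = Hs_norm f.
Proof. by []. Qed.

Lemma Hs_innerxx f : Hs_inner f f = `|f| ^+ 2.
Proof. by rewrite Hs_normE sqr_sqrtr// Hs_inner_ge0. Qed.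

Lemma Hs_norm_le f M : 0 <= M ->
  (forall n, \sum_(0 <= j < n) weight s j * f j ^+ 2 <= M ^+ 2) -> `|f| <= M.
Proof.
move=> M0 fM; rewrite -ler_sqr ?nnegrE// -Hs_innerxx; exact: Hs_inner_le.
Qed.

Lemma Hs_partial_le (f : Hs s) n :
  \sum_(0 <= j < n) weight s j * f j ^+ 2 <= `|f| ^+ 2.
Proof. by rewrite -Hs_innerxx; exact: Hs_inner_ge. Qed.

Lemma Hs_coef_norm (f : Hs s) j : `|f j| <= `|f| / Num.sqrt (weight s j).
Proof.
rewrite ler_pdivlMr ?sqrtr_gt0 ?weight_gt0//.
rewrite -ler_sqr ?nnegrE ?mulr_ge0 ?sqrtr_ge0// exprMn.
rewrite sqr_sqrtr ?(ltW (weight_gt0 _ _))//.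
by rewrite real_normK ?num_real// mulrC -Hs_innerxx; exact: Hs_coef_le.
Qed.

Lemma Hs_complete (F : set_system (Hs s)) :
  ProperFilter F -> cauchy F -> cvg F.
Proof.
move=> FF /cauchyP Fc.
have cj j : cvg ((fun f : Hs s => f j) @ F).
  apply: R_complete; apply/cauchyP => e e0.
  have d0 : 0 < e * Num.sqrt (weight s j).
    by rewrite mulr_gt0// sqrtr_gt0 weight_gt0.
  have [f Ff] := Fc _ d0; exists (f j).
  change (F ((fun h : Hs s => h j) @^-1` ball (f j) e)).
  apply: filterS Ff => g; rewrite -ball_normE /= => fg.
  change (`|f j - g j| < e).
  have := Hs_coef_norm (f - g) j; rewrite HsD HsN => /le_lt_trans; apply.
  by rewrite ltr_pdivrMr// sqrtr_gt0 weight_gt0.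
pose a j := lim ((fun f : Hs s => f j) @ F).
have key e (f : Hs s) : 0 < e -> F (ball f e) -> forall n,
    \sum_(0 <= j < n) weight s j * (f j - a j) ^+ 2 <= e ^+ 2.
  move=> e0 Ff n.
  have cl : (fun g : Hs s => \sum_(0 <= j < n) weight s j * (f j - g j) ^+ 2) @ F
      --> \sum_(0 <= j < n) weight s j * (f j - a j) ^+ 2.
    apply: cvg_big => [|j _]; first exact: add_continuous.
    apply: cvgM; first exact: cvg_cst.
    rewrite expr2; under eq_fun do rewrite expr2.
    by apply: cvgM; (apply: cvgB; [exact: cvg_cst|exact: cj]).
  rewrite -(cvg_lim _ cl)//; apply: limr_le; first exact: cvgP cl.
  apply: filterS Ff => g; rewrite -ball_normE /= => fg.
  have := Hs_partial_le (f - g) n.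
  move=> /le_trans; apply; rewrite ler_sqr ?nnegrE// ?ltW//.
have [f Ff] := Fc 1 ltr01.
have sa : sobolev s a.
  have sd : sobolev s (coef f - a).
    apply: sobolev_bound => n; exact: key Ff n.
  have [_ sm] := sobolev_submod s.
  have := sm (-1) (coef f - a) f; rewrite -!topredE/=.
  move=> /(_ (asboolT sd) (asboolT (HsP f))) /asboolP.
  by rewrite scaleN1r opprB subrK.
pose A : Hs s := MkHs (asboolT sa).
apply: (cvgP A); apply/cvgrPdist_le => /= e e0.
have e20 : 0 < e / 2 by rewrite divr_gt0.
have [g Fg] := Fc _ e20.
have gA : `|g - A| <= e / 2.
  by apply: Hs_norm_le (ltW e20) _ => n; exact: key Fg n.
apply: filterS Fg => h; rewrite -ball_normE /= => gh.
rewrite distrC -(subrK g h) -addrA (le_trans (ler_normD _ _))// (splitr e).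
by rewrite lerD// distrC ltW.
Qed.

HB.instance Definition _ := Uniform_isComplete.Build (Hs s) Hs_complete.
HB.instance Definition _ :=
  NormedModule_hasInner.Build R (Hs s) Hs_innerC Hs_innerDl Hs_innerZl Hs_innerxx.

End sobolev_module.

Arguments HsP {R s} f.

Section basis.
Context {R : realType} (s : R).

Lemma delta_sobolev (i : nat) : sobolev s (fun j => (j == i)%:R : R).
Proof.
apply: (@sobolev_bound _ _ _ (weight s i)) => n.
have [ni|/subnKC <-] := leqP n i.
  rewrite big_nat big1 ?ltW ?weight_gt0// => j jn.
  have -> : (j == i) = false by apply: ltn_eqF; apply: leq_trans ni.
  by rewrite expr0n mulr0.
rewrite (bigD1_seq i) ?iota_uniq ?mem_index_iota//= ?leq_addr//.
rewrite eqxx expr1n mulr1 big1 ?addr0// => j /negPf ->.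
by rewrite expr0n mulr0.
Qed.

Arguments delta_sobolev : clear implicits.

Definition Hs_basis (i : nat) : Hs s := MkHs (asboolT (delta_sobolev i)).

Lemma inner_basisr (f : Hs s) (i : nat) :
  inner f (Hs_basis i) = weight s i * f i.
Proof.
apply: cvg_lim => //; apply: cvg_near_cst; near=> n.
have ni : (i < n)%N by near: n; exact: nbhs_infty_gt.
rewrite /series/= (bigD1_seq i) ?iota_uniq ?mem_index_iota//=.
rewrite eqxx mulr1 big1 ?addr0// => j /negPf ->.
by rewrite !mulr0.
Unshelve. all: by end_near. Qed.

Lemma Hs_basis_inner (i j : nat) :
  inner (Hs_basis i) (Hs_basis j) = j.+1%:R `^ (2 * s) * (i == j)%:R.
Proof. by rewrite inner_basisr/= eq_sym. Qed.

Lemma Hs_basis_cvg (f : Hs s) :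
  (fun n => \sum_(0 <= j < n) f j *: Hs_basis j) @ \oo --> f.
Proof.
pose w j := weight s j * f j ^+ 2.
have pc n i : (\sum_(0 <= j < n) f j *: Hs_basis j) i =
    if (i < n)%N then f i else 0.
  elim: n => [|n IH]; first by rewrite big_geq.
  rewrite big_nat_recr// HsD IH HsZ /= ltnS.
  by case: ltngtP => [h|h|->]; rewrite ?mulr0 ?mulr1 ?addr0 ?add0r.
apply/cvgrPdist_le => e e0.
have /cvgrPdist_le /(_ (e ^+ 2)) : series w @ \oo --> limn (series w) by exact: (HsP f).
move=> /(_ (exprn_gt0 _ e0)) H.
near=> n; apply: Hs_norm_le (ltW e0) _ => m.
have rj j : (f - \sum_(0 <= i < n) f i *: Hs_basis i) j =
    if (j < n)%N then 0 else f j.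
  by rewrite HsD HsN pc; case: ifP => _; rewrite ?subrr ?subr0.
under eq_bigr do rewrite rj.
have Hn : `|limn (series w) - series w n| <= e ^+ 2 by near: n.
have nd : nondecreasing_seq (series w).
  apply: nondecreasing_series => j _ _.
  by rewrite mulr_ge0 ?sqr_ge0// ltW// weight_gt0.
apply: le_trans (le_trans (ler_norm _) Hn).
rewrite lerBrDr (le_trans _ (nondecreasing_cvgn_le nd (HsP f) (maxn m n)))//.
rewrite [leRHS]/series/= [leRHS](big_cat_nat (n := n)) ?leq_maxr//=.
rewrite [leLHS]addrC; apply: lerD; first exact: lexx.
have [mn|nm] := leqP m n.
  rewrite big_nat big1; last first.
    by move=> j jm; rewrite (leq_trans _ mn)// expr0n mulr0.
  by apply: sumr_ge0 => j _; rewrite mulr_ge0 ?sqr_ge0// ltW// weight_gt0.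
rewrite (big_cat_nat (n := n)) ?(ltnW nm)//= big_nat big1 ?add0r; last first.
  by move=> j jn; rewrite (_ : (j < n)%N)// expr0n mulr0.
rewrite le_eqVlt; apply/orP; left; apply/eqP/eq_big_nat => j /andP[nj _].
by rewrite ltnNge nj.
Unshelve. all: by end_near. Qed.

End basis.

(* The image of f under the diagonal operator with eigenvalues (lambda j)^2,
   as an element of H^s'. The default value 0 of insubd is used only if the
   image does not lie in H^s'; see [diag_opE]. *)
Definition diag_op {R : realType} (lambda : nat -> R) (s s' : R) (f : Hs s) :
  Hs s' := insubd 0 (fun j => lambda j ^+ 2 * f j).

Lemma diag_opE {R : realType} (lambda : nat -> R) (kappa s s' : R) (f : Hs s) :
  (forall j, 0 < lambda j) ->
  (limn_esup (fun j => (j.+1%:R `^ kappa * lambda j)%:E) < +oo)%E ->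
  s' <= s + 2 * kappa ->
  forall j, diag_op lambda s' f j = lambda j ^+ 2 * f j.
Proof.
move=> lam0 lamb ss' j.
have [M M0 HM] : exists2 M : R, 0 <= M & forall j, j.+1%:R `^ kappa * lambda j <= M.
  have [_ [V [N _ NV] <-]] := ereal_inf_lt lamb.
  set y := ereal_sup _ => yoo.
  have uy j' : (N <= j')%N -> ((j'.+1%:R `^ kappa * lambda j')%:E <= y)%E.
    by move=> /NV Vj; apply: ereal_sup_ubound; exists j'.
  have u0 j' : 0 <= j'.+1%:R `^ kappa * lambda j'.
    by rewrite mulr_ge0 ?powR_ge0// ltW.
  exists (`|fine y| + \sum_(0 <= i < N) i.+1%:R `^ kappa * lambda i).
    by rewrite addr_ge0// sumr_ge0.
  move=> i; have [Ni|iN] := leqP N i.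
    have := uy i Ni; move: yoo; case: (y) => [r _|//|_].
      rewrite lee_fin => /le_trans; apply; rewrite /= ler_wpDr ?sumr_ge0//.
      exact: ler_norm.
    by rewrite leeNy_eq.
  rewrite ler_wpDl// (bigD1_seq i) ?iota_uniq ?mem_index_iota//=.
  by rewrite lerDl sumr_ge0.
rewrite /diag_op insubdK//; apply/asboolP.
apply: (@sobolev_bound _ _ _ (M ^+ 4 * `|f| ^+ 2)) => n.
apply: le_trans (ler_wpM2l (exprn_ge0 4 M0) (Hs_partial_le f n)).
rewrite mulr_sumr; apply: ler_sum => i _.
rewrite exprMn [leLHS]mulrA [leRHS]mulrA ler_wpM2r ?sqr_ge0// -exprM.
rewrite /weight; set x : R := i.+1%:R.
have x1 : 1 <= x by rewrite ler1n.
have : x `^ (2 * s') <= x `^ (2 * s + 4 * kappa) by rewrite ler_powR//; lra.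
move=> /(ler_wpM2r (exprn_ge0 4 (ltW (lam0 i)))) /le_trans; apply.
rewrite powRD; last by rewrite implybE orbC (gt_eqF (lt_le_trans ltr01 x1)).
have -> : x `^ (4 * kappa) = (x `^ kappa) ^+ 4.
  by rewrite mulrC powRrM -powR_mulrn ?powR_ge0.
rewrite -mulrA -exprMn mulrC ler_wpM2r ?powR_ge0//.
by apply: lerXn2r (HM i); rewrite nnegrE// mulr_ge0 ?powR_ge0// ltW.
Qed.

(* The duality pairing of H^-s with H^s extending the inner product of H; the
   series converges absolutely by the Cauchy-Schwarz inequality. *)
Definition pairing {R : realType} (s : R) (g : Hs (- s)) (h : Hs s) : R :=
  limn (series (fun j => g j * h j)).

Notation borel H := (g_sigma_algebraType (@open H)).

Section hilbert.
Context {R : realType} {H : hilbertType R}.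

Definition orthonormal_basis (phi : nat -> H) : Prop :=
  (forall i j, inner (phi i) (phi j) = (i == j)%:R) /\
  (forall x : H,
    (fun n => \sum_(0 <= j < n) inner x (phi j) *: phi j) @ \oo --> x).

(* mu is N(0, C). The degenerate case is separate because normal_prob m 0 is
   not the Dirac mass at m. *)
Definition centred_gaussian (C : H -> H) (mu : set (borel H) -> \bar R) : Prop :=
  forall (h : H) (A : set (measurableTypeR R)), measurable A ->
    mu ((fun x : H => inner h x) @^-1` A) =
    if inner (C h) h == 0 then \d_(0 : R) A
    else normal_prob 0 (Num.sqrt (inner (C h) h)) A.

(* x : H seen as an element of H^s, with a default value 0 outside of H^s.
   For a Gaussian variable with values in H^s almost surely, the default is
   used on a null set only. *)
Definition to_Hs (phi : nat -> H) (s : R) (x : H) : Hs s :=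
  insubd 0 (fun j => inner x (phi j)).

End hilbert.

Section calculus.
Context {R : realType}.

Definition opnorm {V W : normedModType R} (A : V -> W) : \bar R :=
  ereal_sup [set `|A h|%:E | h in [set h : V | `|h| <= 1]].

Context {V : normedModType R}.

Definition set_arg k (h : 'I_k -> V) (i : 'I_k) (u : V) : 'I_k -> V :=
  fun j => if j == i then u else h j.

Definition cons_arg k (u : V) (h : 'I_k -> V) : 'I_k.+1 -> V :=
  fun i => if unlift ord0 i is Some j then h j else u.

Definition multilinear k (A : ('I_k -> V) -> R) : Prop :=
  forall h i a u v, A (set_arg h i (a *: u + v)) =
    a * A (set_arg h i u) + A (set_arg h i v).

Definition multinorm k (A : ('I_k -> V) -> R) : \bar R :=
  ereal_sup [set `|A h|%:E | h in [set h | forall i, `|h i| <= 1]].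

(* f is of class C^n and, for k <= n, D k x is its k-th Frechet derivative at
   x, seen as a bounded k-linear form; the direction of the last
   differentiation is the first argument. *)
Definition Cn_derivatives n (f : V -> R)
    (D : forall k, V -> ('I_k -> V) -> R) : Prop :=
  [/\ forall x h, D 0%N x h = f x,
      forall k x, (k <= n)%N ->
        multilinear (D k x) /\ (multinorm (D k x) < +oo)%E,
      forall k x, (k < n)%N -> forall e, 0 < e -> \forall u \near (0 : V),
        (multinorm (fun h : 'I_k -> V =>
           (D k (x + u) h - D k x h - D k.+1 x (cons_arg u h))%R) <=
         (e * `|u|)%:E)%E
    & forall x e, 0 < e -> \forall y \near x,
        (multinorm (fun h : 'I_n -> V => (D n y h - D n x h)%R) <= e%:E)%E].

End calculus.

(* [flow] is the flow of q' = v, v' = - q - G q. *)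
Definition is_flow {R : realType} {V : normedModType R} (G : V -> V)
    (flow : R -> V * V -> V * V) : Prop :=
  (forall z, flow 0 z = z) /\
  (forall z (t : R), is_derive t 1 (fun r => flow r z)
    ((flow t z).2, - (flow t z).1 - G (flow t z).1)).

(* Main.v *)
Require Import Defs.
From mathcomp Require Import all_boot all_order all_algebra.
From mathcomp Require Import all_classical all_reals all_analysis.
From mathcomp Require Import ring lra.
Import Order.TTheory GRing.Theory Num.Theory.
Import numFieldNormedType.Exports.

Local Open Scope classical_set_scope.
Local Open Scope ring_scope.

(** The contraction holds for every fixed initial velocity v.  Let z be the
    difference of the two position components and w = z', so that w(0) = 0 and
    w' = -F with |F| <= a |z| and zeta |z|^2 <= <F, z>, where a = L + 1.  With
    m the maximum of |z| on [0, T] and r = |z(0)|, one gets |w(t)| <= a m t and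
    |z(t)|^2 >= r^2 - a m r t^2.  Inserting these in (|z|^2)'' =
    2 |w|^2 - 2 <F, z>, first without and then with the contribution of zeta,
    and integrating twice, yields m^2 <= 6/5 r^2 and then a bound on |z(T)|^2
    with room to spare for the constant 1/27. *)

(** * Inner product identities, continuity and product rule *)

Section inner_product.
Context {R : realType} {V : hilbertType R}.
Implicit Types x y : V.

Lemma normD_sqr x y :
  `|x + y| ^+ 2 = `|x| ^+ 2 + 2 * inner x y + `|y| ^+ 2.
Proof.
rewrite -!innerxx innerDl !(innerC _ (x + y)) !innerDl (innerC y x); ring.
Qed.

(** Lets [inner] inherit its joint continuity from that of the norm; see [cvg_inner]. *)
Lemma inner_polarization x y :
  inner x y = 2^-1 * (`|x + y| ^+ 2 - `|x| ^+ 2 - `|y| ^+ 2).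
Proof. by rewrite normD_sqr; field. Qed.

(** One-sided Cauchy-Schwarz, read off by squaring the triangle inequality and cancelling the
    squares. *)
Lemma inner_le x y : inner x y <= `|x| * `|y|.
Proof.
have : `|x + y| ^+ 2 <= (`|x| + `|y|) ^+ 2.
  by rewrite lerXn2r ?nnegrE ?addr_ge0 ?ler_normD.
rewrite normD_sqr; lra.
Qed.

Lemma innerNl x y : inner (- x) y = - inner x y.
Proof. by rewrite -scaleN1r innerZl mulN1r. Qed.

Lemma innerDr x y z : inner x (y + z) = inner x y + inner x z.
Proof. by rewrite innerC innerDl !(innerC x). Qed.

Lemma innerZr a x y : inner x (a *: y) = a * inner x y.
Proof. by rewrite innerC innerZl innerC. Qed.

Lemma inner0l x : inner 0 x = 0.
Proof. by rewrite -(scale0r 0) innerZl mul0r. Qed.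

Lemma innerNr x y : inner x (- y) = - inner x y.
Proof. by rewrite innerC innerNl innerC. Qed.

Lemma inner0r x : inner x 0 = 0.
Proof. by rewrite innerC inner0l. Qed.

Lemma cvg_inner {I : Type} {F : set_system I} {FF : Filter F}
    {f g : I -> V} {x y} :
  f @ F --> x -> g @ F --> y -> inner (f i) (g i) @[i --> F] --> inner x y.
Proof.
move=> fx gy; rewrite inner_polarization.
under eq_fun do rewrite inner_polarization.
have sqr (h : I -> V) c : h @ F --> c -> `|h i| ^+ 2 @[i --> F] --> `|c| ^+ 2.
  move=> hc; rewrite expr2; under eq_fun do rewrite expr2.
  by apply: cvgM; exact: cvg_norm.
apply: cvgM; first exact: cvg_cst.
by apply: cvgB; [apply: cvgB|]; apply: sqr => //; exact: cvgD.
Qed.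

Lemma is_derive_inner {f g : R -> V} {t : R} {df dg} :
  is_derive t 1 f df -> is_derive t 1 g dg ->
  is_derive t 1 (fun r => inner (f r) (g r)) (inner df (g t) + inner (f t) dg).
Proof.
move=> [f1 fE] [g1 gE].
(* The quotient is split below with [g] taken at the shifted point, so the limit of [g] itself along
   the punctured neighbourhood is required. *)
have gc : (g \o shift t) (h *: 1) @[h --> (0 : R)^'] --> g t.
  have /differentiable_continuous gct : differentiable g t.
    exact/derivable1_diffP.
  have : (g \o shift t) (h *: 1) @[h --> (0 : R)] --> (g \o shift t) (0 *: 1).
    apply: (@continuous_comp _ _ _ (fun h : R => shift t (h *: 1)) g) => /=.
      by apply: cvgD; [apply: cvgZr_tmp; exact: cvg_id|exact: cvg_cst].
    by rewrite scale0r add0r.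
  rewrite /= scale0r add0r; apply: cvg_trans; apply: cvg_app; exact: cvg_within.
have key : h^-1 *: (((fun r => inner (f r) (g r)) \o shift t) (h *: 1) -
    inner (f t) (g t)) @[h --> (0 : R)^'] --> inner df (g t) + inner (f t) dg.
  rewrite -fE -gE.
  under eq_fun => h.
    rewrite (_ : _ *: _ =
        inner (h^-1 *: ((f \o shift t) (h *: 1) - f t))
          ((g \o shift t) (h *: 1)) +
        inner (f t) (h^-1 *: ((g \o shift t) (h *: 1) - g t))); first over.
    rewrite innerZl innerZr innerDl innerNl innerDr innerNr.
    by rewrite /GRing.scale/=; ring.
  apply: cvgD; apply: cvg_inner => //; exact: cvg_cst.
by split; [exact: cvgP key|exact: cvg_lim key].
Qed.

End inner_product.

(** * Derivatives along curves, and bounds by integration *)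

Lemma is_derive_linear_comp {R : realType} {V W : normedModType R}
    (A : {linear V -> W}) {f : R -> V} {t : R} {df} :
  continuous A -> is_derive t 1 f df -> is_derive t 1 (A \o f) (A df).
Proof.
move=> cA [f1 fE].
have key : h^-1 *: (((A \o f) \o shift t) (h *: 1) - (A \o f) t)
    @[h --> (0 : R)^'] --> A df.
  rewrite -fE.
  under eq_fun => h do rewrite /= -linearB -linearZ.
  apply: continuous_cvg; [exact: cA|exact: f1].
by split; [exact: cvgP key|exact: cvg_lim key].
Qed.

(** Integrates a bound on the derivative without any integral: the mean value theorem applies to [f]
    minus the primitive of the bound. Two monomials cover every bound needed; a single one is the
    case of a zero second coefficient. *)
Lemma derive_le_monomials {R : realType} {f df : R -> R}
    {T : R} (A B : R) (n k : nat) :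
  (forall t : R, is_derive t 1 f (df t)) ->
  (forall t : R, 0 <= t <= T ->
     df t <= n.+1%:R * A * t ^+ n + k.+1%:R * B * t ^+ k) ->
  forall t : R, 0 <= t <= T -> f t <= f 0 + A * t ^+ n.+1 + B * t ^+ k.+1.
Proof.
move=> fD df_le t /andP[t0 tT].
pose p : {poly R} := A *: 'X^(n.+1) + B *: 'X^(k.+1).
have gD (s : R) : is_derive s 1 (f - horner p) (df s - (deriv p).[s]).
  exact: is_deriveB.
have gc : {within `[0, t], continuous (f - horner p)}.
  apply: derivable_within_continuous => s _; by have [] := gD s.
have [c] := MVT_segment t0 (fun s _ => gD s) gc.
rewrite in_itv/= => /andP[c0 ct].
have -> : (f - horner p) t = f t - p.[t] by [].
have -> : (f - horner p) 0 = f 0 - p.[0] by [].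
have p0 : p.[0] = 0 by rewrite /p !hornerE/= !expr0n /= !mulr0 addr0.
have pt : p.[t] = A * t ^+ n.+1 + B * t ^+ k.+1 by rewrite /p !hornerE.
have p'c : (deriv p).[c] = n.+1%:R * A * c ^+ n + k.+1%:R * B * c ^+ k.
  by rewrite /p derivD !derivZ !derivXn !(hornerE, hornerMn); ring.
rewrite p0 pt p'c => E.
have : df c - (n.+1%:R * A * c ^+ n + k.+1%:R * B * c ^+ k) <= 0.
  by rewrite subr_le0 df_le// c0 (le_trans ct).
move=> /(ler_wpM2r (_ : 0 <= t - 0)); rewrite subr0 => /(_ t0); rewrite mul0r.
move: E; rewrite !subr0; lra.
Qed.

(* f may be non-measurable: the integral of a nonnegative function is a supremum
   over the simple functions below it, hence monotone. *)
Lemma expectation_le_cst {d : measure_display} {X : measurableType d}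
    {R : realType} {P : probability X R} {f : X -> R} {c : R} :
  0 <= c -> (forall x, 0 <= f x <= c) -> ('E_P[f] <= c%:E)%E.
Proof.
move=> c0 fc; rewrite -(expectation_cst P c) unlock.
rewrite !ge0_integralTE//; last by move=> x; rewrite lee_fin; case/andP: (fc x).
apply/ge_ereal_sup => /= _ [h hf <-]; apply: ereal_sup_ubound.
exists h => //= x.
by apply: le_trans (hf x) _; rewrite lee_fin; case/andP: (fc x).
Qed.

(** * Contraction for the second-order equation z'' = -F *)

Lemma second_order_contraction {R : realType} {V : hilbertType R}
    {z w F : R -> V} {a zeta T : R} :
  0 < a -> 0 < zeta -> zeta <= a -> 0 < T -> T ^+ 2 * a <= zeta / a ->
  (forall t : R, is_derive t 1 z (w t)) ->
  (forall t : R, is_derive t 1 w (- F t)) ->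
  w 0 = 0 ->
  (forall t, `|F t| <= a * `|z t|) ->
  (forall t, zeta * `|z t| ^+ 2 <= inner (F t) (z t)) ->
  `|z T| <= (1 - 27^-1 * zeta * T ^+ 2) * `|z 0|.
Proof.
move=> a0 ze0 zea T0 Ta zD wD w0 F_le F_ge.
have aT1 : a * T ^+ 2 <= 1.
  by rewrite mulrC (le_trans Ta)// ler_pdivrMr// mul1r.
have aaT : a ^+ 2 * T ^+ 2 <= zeta.
  have -> : a ^+ 2 * T ^+ 2 = T ^+ 2 * a * a by ring.
  by rewrite -ler_pdivlMr.
have zc : {within `[0, T], continuous (fun t => `|z t|)}.
  apply: continuous_subspaceT => t; apply: cvg_norm.
  by apply: differentiable_continuous; apply/derivable1_diffP; have [] := zD t.
have [c cT z_le] := EVT_max (ltW T0) zc.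
pose m := `|z c|.
have {}z_le (t : R) : 0 <= t <= T -> `|z t| <= m.
  by move=> tT; apply: z_le; rewrite in_itv.
have c_itv : 0 <= c <= T by move: cT; rewrite in_itv.
have m0 : 0 <= m by exact: normr_ge0.
have cst_D (e : V) (t : R) : is_derive t 1 (fun=> e) 0 by exact: is_derive_cst.
(* Pairing with a fixed [e] reduces the growth of [w] to a scalar estimate; [w_le] then takes [e] to
   be [w t] and divides by its norm. *)
have w_inner_le (e : V) (t : R) : 0 <= t <= T ->
    inner (w t) e <= a * m * `|e| * t.
  move=> tT.
  have := derive_le_monomials (a * m * `|e|) 0 0 0
    (fun s => is_derive_inner (wD s) (cst_D e s)) _ _ tT.
  rewrite w0 inner0l add0r mul0r addr0 expr1; apply=> s sT.
  rewrite expr0 !mulr1 mulr0 addr0 mul1r inner0r addr0.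
  rewrite (le_trans (inner_le _ _))// ler_wpM2r// normrN (le_trans (F_le _))//.
  by rewrite ler_pM2l// z_le.
have w_le (t : R) : 0 <= t <= T -> `|w t| <= a * m * t.
  move=> tT; have [->|wt0] := eqVneq (w t) 0.
    by case/andP: tT => t0 _; rewrite normr0 !mulr_ge0// ltW.
  rewrite -(ler_pM2r (_ : 0 < `|w t|)) ?normr_gt0//.
  by rewrite -expr2 -innerxx mulrAC w_inner_le.
pose r := `|z 0|.
have r0 : 0 <= r by exact: normr_ge0.
(* The lower bound comes from an upper bound on the pairing with [- z 0], whose derivative
   [w_inner_le] controls. *)
have z_inner_ge (t : R) : 0 <= t <= T ->
    r ^+ 2 - 2^-1 * a * m * r * t ^+ 2 <= inner (z t) (z 0).
  move=> tT.
  have := derive_le_monomials (2^-1 * a * m * r) 0 1 0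
    (fun s => is_derive_inner (zD s) (cst_D (- z 0) s)) _ _ tT.
  rewrite mul0r addr0 !innerNr innerxx -/r.
  suff H : forall s : R, 0 <= s <= T ->
      inner (w s) (- z 0) + inner (z s) 0 <=
        2 * (2^-1 * a * m * r) * s ^+ 1 + 1%:R * 0 * s ^+ 0.
    by move=> /(_ H); lra.
  move=> s sT; have := w_inner_le (- z 0) s sT.
  by rewrite inner0r normrN expr1 -/r; lra.
(* From |z(t) - z(0)|^2 >= 0, that is |z(t)|^2 >= 2 <z(t), z(0)> - r^2. *)
have z_sqr_ge (t : R) : 0 <= t <= T ->
    r ^+ 2 - a * m * r * t ^+ 2 <= `|z t| ^+ 2.
  move=> /z_inner_ge; have := normD_sqr (z t) (- z 0).
  rewrite innerNr normrN -/r.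
  have := sqr_ge0 `|z t - z 0|; lra.
have p_D (t : R) := is_derive_inner (wD t) (zD t).
have h_D (t : R) := is_derive_inner (zD t) (zD t).
have p_0 : inner (w 0) (z 0) = 0 by rewrite w0 inner0l.
(* The derivative of |z|^2 is 2 <w, z>, so the bound doubles to 6 A t^3 + 2 B t before it is
   integrated. *)
have h_le A B : (forall t : R, 0 <= t <= T -> inner (w t) (z t) <=
      3 * A * t ^+ 3 + B * t) -> forall t : R, 0 <= t <= T ->
    `|z t| ^+ 2 <= r ^+ 2 + 3 / 2 * A * t ^+ 4 + B * t ^+ 2.
  move=> pAB t tT.
  have := derive_le_monomials (3 / 2 * A) B 3 1
    h_D _ _ tT; rewrite !innerxx; apply=> s sT.
  rewrite (innerC (z s)) expr1; have := pAB s sT; lra.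
have w_sqr_le (t : R) : 0 <= t <= T ->
    inner (w t) (w t) <= a ^+ 2 * m ^+ 2 * t ^+ 2.
  move=> tT; rewrite innerxx -!exprMn lerXn2r ?nnegrE ?w_le//.
  by case/andP: tT => t0 _; rewrite !mulr_ge0// ltW.
(* First pass, with <F, z> >= 0 only: at the maximum point [c] it gives m^2 <= r^2 + a^2 m^2 c^4 /
   6, and a c^2 <= 1 lets the last term be absorbed. *)
have m_le : m ^+ 2 <= 6 / 5 * r ^+ 2.
  have p_le (t : R) : 0 <= t <= T ->
      inner (w t) (z t) <= 3 * (9^-1 * a ^+ 2 * m ^+ 2) * t ^+ 3 + 0 * t.
    move=> tT.
    have := derive_le_monomials (3^-1 * a ^+ 2 * m ^+ 2) 0 2
      0 p_D _ _ tT; rewrite p_0 => H; apply: le_trans (H _) _; last by lra.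
    move=> s sT; rewrite innerNl; have := w_sqr_le s sT; have := F_ge s.
    have : 0 <= zeta * `|z s| ^+ 2 by rewrite mulr_ge0 ?sqr_ge0// ltW.
    lra.
  have := h_le _ _ p_le c c_itv; rewrite -/m.
  have : a ^+ 2 * c ^+ 4 <= 1.
    have /andP[c0 cT'] := c_itv.
    have ac1 : a * c ^+ 2 <= 1.
      by apply: le_trans aT1; rewrite ler_pM2l// lerXn2r ?nnegrE// ltW.
    rewrite (_ : a ^+ 2 * _ = (a * c ^+ 2) ^+ 2); last by ring.
    by rewrite exprn_ile1// mulr_ge0 ?sqr_ge0// ltW.
  move=> /(ler_wpM2r (sqr_ge0 m)); lra.
(* 11/10 is a rational upper bound for the square root of 6/5. *)
have m_le2 : m * r <= 11 / 10 * r ^+ 2.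
  have : (m - 11 / 10 * r) * r <= 0; last by lra.
  rewrite mulr_le0_ge0// subr_le0 -(ler_pXn2r (n := 2))// ?nnegrE//.
    have := sqr_ge0 r; lra.
  lra.
have T_itv : 0 <= T <= T by rewrite lexx ltW.
(* Second pass: [z_sqr_ge] turns -<F, z> into -zeta r^2 + zeta a m r t^2, whose constant term
   produces the decay. *)
have := h_le (9^-1 * (a ^+ 2 * m ^+ 2 + zeta * (a * m * r)))
  (- zeta * r ^+ 2) _ T T_itv.
have p_le (t : R) : 0 <= t <= T -> inner (w t) (z t) <=
    3 * (9^-1 * (a ^+ 2 * m ^+ 2 + zeta * (a * m * r))) * t ^+ 3 +
    - zeta * r ^+ 2 * t.
  move=> tT.
  have := derive_le_monomials (3^-1 * (a ^+ 2 * m ^+ 2 + zeta * (a * m * r)))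
    (- zeta * r ^+ 2) 2 0 p_D _ _ tT; rewrite p_0 => H.
  apply: le_trans (H _) _; last by lra.
  move=> s sT; rewrite innerNl; have := w_sqr_le s sT; have := F_ge s.
  have := ler_wpM2l (ltW ze0) (z_sqr_ge s sT); rewrite expr0; lra.
move=> /(_ p_le) hT.
pose x := zeta * T ^+ 2.
have x0 : 0 <= x by rewrite mulr_ge0 ?sqr_ge0// ltW.
have x1 : x <= 1 by apply: le_trans aT1; rewrite ler_wpM2r ?sqr_ge0.
have e1 : a ^+ 2 * T ^+ 4 * m ^+ 2 <= x * (6 / 5 * r ^+ 2).
  apply: ler_pM => //; rewrite ?sqr_ge0//.
    by rewrite mulr_ge0// ?sqr_ge0// exprn_ge0// ltW.
  rewrite (_ : _ ^+ 2 * _ = (a ^+ 2 * T ^+ 2) * T ^+ 2); last by ring.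
  by rewrite ler_wpM2r ?sqr_ge0.
have e2 : (x * (a * T ^+ 2)) * (m * r) <= x * (11 / 10 * r ^+ 2).
  apply: ler_pM m_le2; last by rewrite ler_piMr.
    by rewrite !mulr_ge0 ?sqr_ge0// ltW.
  by rewrite mulr_ge0.
have xr : 0 <= x * r ^+ 2 by rewrite mulr_ge0 ?sqr_ge0.
(* By [e1] and [e2] the T^4 terms are at most (6/5 + 11/10) x r^2 / 6, so |z(T)|^2 <= (1 - 37/60 x)
   r^2, while the target exceeds (1 - 2/27 x) r^2 by a square. *)
have {}hT : `|z T| ^+ 2 <= (1 - 27^-1 * x) ^+ 2 * r ^+ 2.
  have : 0 <= x ^+ 2 * r ^+ 2 by rewrite mulr_ge0 ?sqr_ge0.
  move: hT e1 e2 xr; rewrite /x; lra.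
rewrite -mulrA -/x -/r.
have c0 : 0 <= 1 - 27^-1 * x by lra.
by rewrite -(ler_pXn2r (n := 2)) ?nnegrE ?mulr_ge0// exprMn.
Qed.

(** * Application to the flow, one velocity at a time *)

Theorem theorem3p1 (R : realType) (H : hilbertType R)
  (phi : nat -> H) (C : {linear H -> H}) (lambda : nat -> R)
  (pi0 : probability (borel H) R) (kappa l : R)
  (Phi : Hs l -> R) (DPhi : Hs l -> Hs (- l))
  (L L' zeta M NPhi T : R)
  (flow : R -> Hs l * Hs l -> Hs l * Hs l)
  (phi_basis : orthonormal_basis phi)
  (C_cont : continuous C) (C_inj : injective C)
  (C_eigen : forall j, C (phi j) = lambda j ^+ 2 *: phi j)
  (lambda_gt0 : forall j, 0 < lambda j)
  (pi0_gauss : centred_gaussian C pi0)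
  (S1_kappa : 2^-1 < kappa)
  (S1_liminf :
     (0 < limn_einf (fun j => (j.+1%:R `^ kappa * lambda j)%:E))%E)
  (S1_limsup :
     (limn_esup (fun j => (j.+1%:R `^ kappa * lambda j)%:E) < +oo)%E)
  (S2_l_ge0 : 0 <= l) (S2_l_lt : l < kappa - 2^-1)
  (S2_cont : continuous Phi)
  (S2_diff : forall q : Hs l, differentiable Phi q)
  (S2_DPhi : forall q h : Hs l, 'd Phi q h = pairing (DPhi q) h)
  (S2_lip : lipschitz DPhi)
  (S3 : forall eps : R, 0 < eps ->
     exists K : R, forall q : Hs l, Phi q >= K - eps * `|q| ^+ 2)
  (A1_L : 0 < L) (A1_L' : 0 <= L')
  (A1_lip : forall q q' : Hs l, `|DPhi q - DPhi q'| <= L * `|q - q'|)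
  (A1_C_lip : forall q q' : Hs l,
     `|diag_op lambda l (DPhi q) - diag_op lambda l (DPhi q')| <=
       L * `|q - q'|)
  (A1_bnd : forall q : Hs l, `|DPhi q| <= L * `|q| + L')
  (A1_C_bnd : forall q : Hs l, `|diag_op lambda l (DPhi q)| <= L * `|q| + L')
  (A2_zeta : 0 < zeta) (A2_zeta_le : zeta <= L + 1)
  (A2_mono : forall x y : Hs l,
     inner (x - y) (x - y) +
     inner (diag_op lambda l (DPhi x) - diag_op lambda l (DPhi y)) (x - y) >=
       zeta * `|x - y| ^+ 2)
  (A3_C4 : exists2 D, Cn_derivatives 4 Phi D &
     forall x : Hs l, (multinorm (D 4%N x) <= NPhi%:E)%E)
  (A3_D2 : forall x y : Hs l,
     (opnorm (fun h : Hs l => ('d DPhi x h - 'd DPhi y h)%R) <= (M * `|x - y|)%:E)%E)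
  (A3_CD2 : forall x y : Hs l,
     (opnorm (fun h : Hs l => (diag_op lambda l ('d DPhi x h) -
                               diag_op lambda l ('d DPhi y h))%R) <=
       (M * `|x - y|)%:E)%E)
  (flowP : is_flow (fun q => diag_op lambda l (DPhi q)) flow)
  (T_gt0 : 0 < T) (T_le : T ^+ 2 * (L + 1) <= zeta / (L + 1)) :
  forall x y : Hs l,
  ('E_pi0[fun v => (`|(flow T (x, to_Hs phi l v)).1 -
                     (flow T (y, to_Hs phi l v)).1|)%R]
   <= ((1 - 27%:R^-1 * zeta * T ^+ 2) * `|x - y|)%:E)%E.
Proof.
move=> x y; set a := L + 1; have a0 : 0 < a by rewrite /a; lra.
pose G q := diag_op lambda l (DPhi q).
have [flow0 flowD] := flowP.
have aT1 : T ^+ 2 * a <= 1.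
  by rewrite (le_trans T_le)// ler_pdivrMr// mul1r.
have zT1 : zeta * T ^+ 2 <= 1.
  by rewrite mulrC (le_trans _ aT1)// ler_wpM2l ?sqr_ge0.
apply: expectation_le_cst => [|v]; first by rewrite mulr_ge0//; lra.
(* The bound holds for any common starting velocity, so the default value of [to_Hs] is harmless. *)
rewrite normr_ge0/=; set v' := to_Hs phi l v.
have cont_fst : continuous (@fst (Hs l) (Hs l)) by move=> z; exact: cvg_fst.
have cont_snd : continuous (@snd (Hs l) (Hs l)) by move=> z; exact: cvg_snd.
pose q u t := (flow t (u, v')).1.
pose w u t := (flow t (u, v')).2.
have qD u (t : R) : is_derive t 1 (q u) (w u t).
  exact: (is_derive_linear_comp fst cont_fst (flowD (u, v') t)).
have wD u (t : R) : is_derive t 1 (w u) (- q u t - G (q u t)).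
  exact: (is_derive_linear_comp snd cont_snd (flowD (u, v') t)).
have q0 u : q u 0 = u by rewrite /q flow0.
have w0 u : w u 0 = v' by rewrite /w flow0.
(* Exhibits the right-hand norm as that of the position difference at time 0. *)
rewrite -[in leRHS](q0 x) -[in leRHS](q0 y).
apply: (@second_order_contraction _ _ ( q x - q y) (w x - w y)
  (fun t => (q x t - q y t) + (G (q x t) - G (q y t)))
  a zeta T a0 A2_zeta) => //.
- move=> t; apply: is_derive_eq (is_deriveB (wD x t) (wD y t)) _.
  by rewrite !opprD !opprK addrACA.
- by rewrite !fctE !w0 subrr.
- move=> t; rewrite (le_trans (ler_normD _ _))// /a mulrDl mul1r addrC lerD//.
  exact: A1_C_lip.
- by move=> t; rewrite innerDl; apply: A2_mono.
Qed.
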